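(* Let $\mathcal{R}$ be a commutative ring, let $(a,b)\in\mathcal{R}^2$, and let $\mathbf{M}$ be an $\mathcal{R}$-module. Then there are isomorphisms of $\mathcal{R}$-modules $$\mathcal{F}_{\mathbf{M}}(a,b)\cong \mathbf{M}\oplus\mathbf{M}\cong \mathcal{F}(a,b)\otimes_{\mathcal{R}}\mathbf{M}.$$
   Context: For a commutative ring $\mathcal{R}$, an $\mathcal{R}$-module $\mathbf{M}$ and $(a,b)\in\mathcal{R}^2$, the Fibonacci module $\mathcal{F}_{\mathbf{M}}(a,b)$ is the $\mathcal{R}$-module (under termwise operations) of all sequences $(x_n)_{n\ge 0}$ with $x_n\in\mathbf{M}$ and $x_{n+2}=a x_{n+1}+b x_n$ for all $n\ge 0$. When $\mathbf{M}=\mathcal{R}$ one writes $\mathcal{F}(a,b)$. *)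

(* Defs.v *)
From HB Require Import structures.
From mathcomp Require Import all_boot all_algebra.
From mathcomp Require Import all_classical.

Set Implicit Arguments.
Unset Strict Implicit.
Unset Printing Implicit Defensive.

Import GRing.Theory.

Local Open Scope ring_scope.
Local Open Scope classical_set_scope.
Local Open Scope quotient_scope.

Definition lmod_iso (R : pzRingType) (U V : lmodType R) : Prop :=
  exists f : {linear U -> V}, bijective f.

Section FibonacciModule.
Variables (R : comPzRingType) (M : lmodType R) (a b : R).

Definition fib_seq : {pred nat -> M} :=
  [pred x : nat -> M | `[< forall n, x n.+2 = a *: x n.+1 + b *: x n >]].

Lemma fib_seq_submod_closed : submod_closed fib_seq.
Proof.
split; first by apply/asboolP => n; rewrite !scaler0 addr0.
move=> c x y /asboolP xP /asboolP yP; apply/asboolP => n.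
have E k : (c *: x + y) k = c *: x k + y k by [].
by rewrite !E xP yP !scalerDr !scalerA addrACA ![c * _]mulrC.
Qed.

HB.instance Definition _ :=
  GRing.isSubmodClosed.Build R (nat -> M) fib_seq fib_seq_submod_closed.

Record fibonacci_module : Type := FibonacciModule {
  fib_val :> nat -> M;
  fib_valP : fib_val \in fib_seq
}.

HB.instance Definition _ := [isSub for fib_val].
HB.instance Definition _ := [Choice of fibonacci_module by <:].
(* The operations are those of [nat -> M], i.e. termwise. *)
HB.instance Definition _ := [SubChoice_isSubLmodule of fibonacci_module by <:].

End FibonacciModule.

(* The free module on [X], as the finitely supported functions [X -> R]. *)
Section FreeModule.
Variables (R : comPzRingType) (X : choiceType).

Definition fin_supp : {pred X -> R^o} :=
  [pred f : X -> R^o | `[< finite_set [set x | f x != 0] >]].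

Lemma fin_supp_submod_closed : submod_closed fin_supp.
Proof.
split.
  apply/asboolP; rewrite (_ : mkset _ = set0) //.
  by apply/seteqP; split=> x //=; rewrite eqxx.
move=> c f g /asboolP fP /asboolP gP; apply/asboolP.
have fgP : finite_set ([set x | f x != 0] `|` [set x | g x != 0]).
  by rewrite finite_setU.
apply: sub_finite_set fgP => x /=.
have -> : (c *: f + g) x = c *: f x + g x by [].
have [->|fx0] := eqVneq (f x) 0; last by left.
by rewrite scaler0 add0r; right.
Qed.

HB.instance Definition _ :=
  GRing.isSubmodClosed.Build R (X -> R^o) fin_supp fin_supp_submod_closed.

Record free_module : Type := FreeModule {
  free_val :> X -> R^o;
  free_valP : free_val \in fin_supp
}.

HB.instance Definition _ := [isSub for free_val].
HB.instance Definition _ := [Choice of free_module by <:].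
HB.instance Definition _ := [SubChoice_isSubLmodule of free_module by <:].

Lemma fin_supp_indic (x : X) : (fun y => (y == x)%:R : R^o) \in fin_supp.
Proof.
apply/asboolP; apply: (sub_finite_set _ (finite_set1 x)) => y /=.
by have [->|] := eqVneq y x => //; rewrite eqxx.
Qed.

Definition free_basis (x : X) : free_module := FreeModule (fin_supp_indic x).

End FreeModule.

(* The quotient of [V] by the submodule generated by [G]. *)
Section QuotientModule.
Variables (R : comPzRingType) (V : lmodType R) (G : set V).

Definition gen_submod : {pred V} :=
  [pred v : V | `[< forall S : {pred V},
     submod_closed S -> (forall g, G g -> g \in S) -> v \in S >]].

Lemma gen_submod_closed : submod_closed gen_submod.
Proof.
split; first by apply/asboolP => S [].
move=> c u v /asboolP uP /asboolP vP; apply/asboolP => S SP GS.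
by apply: SP.2; [exact: uP|exact: vP].
Qed.

HB.instance Definition _ :=
  GRing.isSubmodClosed.Build R V gen_submod gen_submod_closed.

Definition quotient_module : Type := Quotient.quot gen_submod.

HB.instance Definition _ := GRing.Zmodule.on quotient_module.
HB.instance Definition _ := ZmodQuotient.on quotient_module.

Definition quot_scale (c : R) (q : quotient_module) : quotient_module :=
  \pi_quotient_module (c *: repr q).

Lemma quot_scaleE c (v : V) : quot_scale c (\pi_quotient_module v) =
  \pi_quotient_module (c *: v).
Proof.
apply/eqP; rewrite -Quotient.idealrBE -scalerBr rpredZ //.
by rewrite Quotient.idealrBE reprK.
Qed.

Lemma quot_scaleA c d q :
  quot_scale c (quot_scale d q) = quot_scale (c * d) q.
Proof.
by rewrite -[q]reprK [quot_scale d _]quot_scaleE !quot_scaleE scalerA.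
Qed.

Lemma quot_scale1 : left_id 1 quot_scale.
Proof. by move=> q; rewrite -[q]reprK quot_scaleE scale1r. Qed.

Lemma quot_scaleDr : right_distributive quot_scale +%R.
Proof.
move=> c p q; rewrite -[p]reprK -[q]reprK.
by rewrite -raddfD !quot_scaleE scalerDr raddfD.
Qed.

Lemma quot_scaleDl q : {morph quot_scale^~ q : c d / c + d}.
Proof.
by move=> c d; rewrite -[q]reprK !quot_scaleE scalerDl raddfD.
Qed.

HB.instance Definition _ := GRing.Zmodule_isLmodule.Build R quotient_module
  quot_scaleA quot_scale1 quot_scaleDr quot_scaleDl.

End QuotientModule.

Section TensorProduct.
Variables (R : comPzRingType) (U V : lmodType R).

Definition free_pair (u : U) (v : V) : free_module R (U * V)%type :=
  free_basis R (u, v).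

Inductive tensor_rel : set (free_module R (U * V)%type) :=
| TensorDl u u' v :
    tensor_rel (free_pair (u + u') v - free_pair u v - free_pair u' v)
| TensorDr u v v' :
    tensor_rel (free_pair u (v + v') - free_pair u v - free_pair u v')
| TensorZl c u v : tensor_rel (free_pair (c *: u) v - c *: free_pair u v)
| TensorZr c u v : tensor_rel (free_pair u (c *: v) - c *: free_pair u v).

Definition tensor_product : lmodType R := quotient_module tensor_rel.

End TensorProduct.

(* Main.v *)
(** A second-order recurrence is determined by its two initial terms, freely
    chosen in [M]; this gives the first isomorphism. Applied to [M = R], it shows
    that the Fibonacci module of [R] is free on the sequences [e0], [e1] with
    initial terms [(1, 0)] and [(0, 1)], so [(u, v) |-> e0 (x) u + e1 (x) v] is the
    second isomorphism: its inverse is induced by [x (x) m |-> (x 0 m, x 1 m)]. *)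
From HB Require Import structures.
Require Import Defs.
From mathcomp Require Import all_boot all_algebra.
From mathcomp Require Import finmap all_classical.

Set Implicit Arguments.
Unset Strict Implicit.
Unset Printing Implicit Defensive.

Import GRing.Theory.

Local Open Scope ring_scope.
Local Open Scope classical_set_scope.
Local Open Scope quotient_scope.

Section FreeModuleTheory.
Variables (R : comPzRingType) (X : choiceType).
Implicit Types f g : free_module R X.

Lemma free_support_finite f : finite_set [set x | f x != 0].
Proof. by case: f => f fP; apply/asboolP; exact: fP. Qed.

Lemma free_basisZE (c : R) (x y : X) :
  (c *: free_basis R x) y = c * (y == x)%:R.
Proof. by []. Qed.

(** At a point [y] of [A] only the term [x = y] survives; at any other point every term vanishes,
    and so does [f]. *)
Lemma free_val_sum f (A : {fset X}) : (forall x, x \notin A -> f x = 0) ->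
  f = \sum_(x <- A) (f x : R) *: free_basis R x.
Proof.
move=> fA; apply/val_inj/funext => y.
have sumE (I : Type) (r : seq I) (F : I -> free_module R X) :
    val (\sum_(i <- r) F i) y = \sum_(i <- r) F i y.
  by elim/big_rec2: _ => // i s t _ <-.
rewrite sumE; under eq_bigr do rewrite free_basisZE.
have [yA|yA] := boolP (y \in A).
  rewrite (big_fsetD1 y yA) eqxx mulr1 big1_seq ?Monoid.mulm1 // => x /andP[_].
  by rewrite !inE eq_sym => /andP[/negbTE -> _]; rewrite mulr0.
rewrite [LHS]fA// big1_seq// => x /andP[_ xA].
by case: eqVneq xA yA => [-> ->|_ _ _] //; rewrite mulr0.
Qed.

Lemma free_basis_span f :
  f = \sum_(x <- fset_set [set x | f x != 0]) (f x : R) *: free_basis R x.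
Proof.
apply: free_val_sum => x; rewrite in_fset_set; last exact: free_support_finite.
by rewrite notin_setE /= => /negP; rewrite negbK => /eqP.
Qed.

Lemma free_module_ext (W : lmodType R) (p q : {linear free_module R X -> W}) :
  (forall x, p (free_basis R x) = q (free_basis R x)) -> p =1 q.
Proof.
move=> pq f; rewrite (free_basis_span f) !linear_sum.
by apply: eq_bigr => x _; rewrite !linearZ /= pq.
Qed.

(** Existence half of the universal property of the free module; [free_module_ext] is the uniqueness
    half. *)
Lemma free_module_lift (W : lmodType R) (h : X -> W) :
  exists p : {linear free_module R X -> W}, forall x, p (free_basis R x) = h x.
Proof.
pose F f := \sum_(x \in setT) (f x : R) *: h x.
(* Any finite set containing the support computes [F f], so linearity can be checked with [f], [g]
   and [c *: f + g] all summed over one common set. *)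
have FE f (A : {fset X}) : (forall x, x \notin A -> f x = 0) ->
    F f = \sum_(x <- A) (f x : R) *: h x.
  by move=> fA; apply: fsbigTE => x /fA ->; rewrite scale0r.
have Flin : linear F.
  move=> c f g.
  have [A fgA] : exists A : {fset X}, forall x, x \notin A -> f x = 0 /\ g x = 0.
    exists (fset_set ([set x | f x != 0] `|` [set x | g x != 0])) => x.
    rewrite in_fset_set; last first.
      by rewrite finite_setU; split; exact: free_support_finite.
    rewrite notin_setE /= => /not_orP[/negP + /negP].
    by rewrite !negbK => /eqP -> /eqP ->.
  have fgE x : (c *: f + g) x = c * (f x : R) + g x by [].
  rewrite !(FE _ A); try by move=> x /fgA[fx gx]; rewrite ?fgE ?fx ?gx ?mulr0 ?addr0.
  rewrite scaler_sumr -big_split; apply: eq_bigr => x _.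
  by rewrite fgE scalerDl scalerA.
pose p : {linear _ -> W} := HB.pack F (GRing.isLinear.Build R _ W _ F Flin).
exists p => x /=.
rewrite (FE _ [fset x]%fset) => [|y].
  by rewrite big_seq_fset1 /= eqxx scale1r.
by rewrite inE /= => /negbTE ->.
Qed.

End FreeModuleTheory.

Section QuotientModuleTheory.
Variables (R : comPzRingType) (V : lmodType R) (G : set V).

Lemma quot_pi_linear : linear (\pi_(quotient_module G) : V -> quotient_module G).
Proof. by move=> c u v; rewrite raddfD; congr (_ + _); exact/esym/quot_scaleE. Qed.

HB.instance Definition _ := GRing.isLinear.Build R V (quotient_module G) _
  (\pi_(quotient_module G) : V -> quotient_module G) quot_pi_linear.

Lemma quot_pi_gen g : G g -> \pi_(quotient_module G) g = 0.
Proof.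
move=> Gg; rewrite -(raddf0 (\pi_(quotient_module G))).
apply/eqP; rewrite -Quotient.idealrBE subr0.
by apply/asboolP => S _; apply.
Qed.

(** Applying [p] to a chosen representative does not depend on the choice: the kernel of [p] is a
    submodule containing [G], hence contains all of [gen_submod G]. *)
Lemma quotient_lift (W : lmodType R) (p : {linear V -> W}) :
  (forall g, G g -> p g = 0) ->
  exists q : {linear quotient_module G -> W},
    forall v, q (\pi_(quotient_module G) v) = p v.
Proof.
move=> pG; pose F (t : quotient_module G) := p (repr t).
have FE v : F (\pi_(quotient_module G) v) = p v.
  have : repr (\pi_(quotient_module G) v) - v \in gen_submod G.
    by rewrite Quotient.idealrBE reprK.
  move/asboolP/(_ [pred u | p u == 0]) => kerp.
  apply/eqP; rewrite -subr_eq0 -linearB; apply: kerp => [|g /pG gp]; last first.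
    by rewrite inE gp.
  split=> [|c u u']; first by rewrite inE linear0.
  by rewrite !inE linearP => /eqP -> /eqP ->; rewrite scaler0 addr0.
have Flin : linear F.
  move=> c s t; rewrite -[s]reprK -[t]reprK -quot_pi_linear !FE.
  by rewrite linearP.
pose q : {linear _ -> W} := HB.pack F (GRing.isLinear.Build R _ W _ F Flin).
by exists q.
Qed.

End QuotientModuleTheory.

Section TensorProductTheory.
Variables (R : comPzRingType) (U V : lmodType R).

Definition tensor (u : U) (v : V) : tensor_product U V :=
  \pi_(quotient_module (@tensor_rel R U V)) (free_pair u v).

Lemma tensorDl u u' v : tensor (u + u') v = tensor u v + tensor u' v.
Proof.
apply/eqP; rewrite -subr_eq0 opprD addrA -!raddfB; apply/eqP.
exact: quot_pi_gen (TensorDl u u' v).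
Qed.

Lemma tensorDr u v v' : tensor u (v + v') = tensor u v + tensor u v'.
Proof.
apply/eqP; rewrite -subr_eq0 opprD addrA -!raddfB; apply/eqP.
exact: quot_pi_gen (TensorDr u v v').
Qed.

Lemma tensorZl c u v : tensor (c *: u) v = c *: tensor u v.
Proof.
apply/eqP; rewrite -subr_eq0 -linearZ -linearB; apply/eqP.
exact: quot_pi_gen (TensorZl c u v).
Qed.

Lemma tensorZr c u v : tensor u (c *: v) = c *: tensor u v.
Proof.
apply/eqP; rewrite -subr_eq0 -linearZ -linearB; apply/eqP.
exact: quot_pi_gen (TensorZr c u v).
Qed.

(** Pure tensors are the images of the basis of the free module, so both maps agree once composed
    with the projection. *)
Lemma tensor_ext (W : lmodType R) (p q : {linear tensor_product U V -> W}) :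
  (forall u v, p (tensor u v) = q (tensor u v)) -> p =1 q.
Proof.
move=> pq t; rewrite -[t]reprK.
pose pi : {linear _ -> tensor_product U V} :=
  \pi_(quotient_module (@tensor_rel R U V)).
by apply: (free_module_ext (p := p \o pi) (q := q \o pi)) => -[u v]; exact: pq.
Qed.

Lemma tensor_lift (W : lmodType R) (B : U -> V -> W) :
  (forall v, linear (B^~ v)) -> (forall u, linear (B u)) ->
  exists p : {linear tensor_product U V -> W},
    forall u v, p (tensor u v) = B u v.
Proof.
move=> Bl Br.
have [p pE] := free_module_lift (fun uv => B uv.1 uv.2).
(* The first goal is that [p] kills the four families of relations. Additivity of [B] is linearity
   with scalar 1; homogeneity is linearity with second summand 0, once [B 0 v] and [B u 0] are known
   to vanish. *)
have [g|q qE] := @quotient_lift R _ (@tensor_rel R U V) W p.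
  have BlD u u' v : B (u + u') v = B u v + B u' v.
    by have := Bl v 1 u u'; rewrite !scale1r.
  have BrD u v v' : B u (v + v') = B u v + B u v'.
    by have := Br u 1 v v'; rewrite !scale1r.
  have Bl0 v : B 0 v = 0 by apply: (addrI (B 0 v)); rewrite -BlD !addr0.
  have Br0 u : B u 0 = 0 by apply: (addrI (B u 0)); rewrite -BrD !addr0.
  case=> [u u' v|u v v'|c u v|c u v]; rewrite !linearB ?linearZ /= !pE /=.
  - by rewrite BlD -addrA -opprD subrr.
  - by rewrite BrD -addrA -opprD subrr.
  - by have := Bl v c u 0; rewrite Bl0 !addr0 => ->; rewrite scalerN subrr.
  - by have := Br u c v 0; rewrite Br0 !addr0 => ->; rewrite scalerN subrr.
by exists q => u v; rewrite [LHS]qE pE.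
Qed.

End TensorProductTheory.

Section FibonacciModuleTheory.
Variables (R : comPzRingType) (M : lmodType R) (a b : R).
Implicit Types (x y : fibonacci_module M a b) (u v : M).

Lemma fib_rec x n : x n.+2 = a *: x n.+1 + b *: x n.
Proof. by have /asboolP := fib_valP x; apply. Qed.

Lemma fib_eq x y : x 0%N = y 0%N -> x 1%N = y 1%N -> x = y.
Proof.
move=> xy0 xy1; apply/val_inj/funext => n.
(* The recurrence looks back two terms, so the induction carries two consecutive equalities. *)
suff [] : x n = y n /\ x n.+1 = y n.+1 by [].
by elim: n => // n [IH0 IH1]; split=> //; rewrite !fib_rec IH0 IH1.
Qed.

(** Iterating on pairs of consecutive terms makes the recurrence first-order, so that it holds by
    computation. *)
Definition fib_iter u v n : M :=
  (iter n (fun p : M * M => (p.2, a *: p.2 + b *: p.1)) (u, v)).1.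

Lemma fib_iter_seq u v : fib_iter u v \in fib_seq a b.
Proof. by apply/asboolP. Qed.

Definition fib_init u v : fibonacci_module M a b :=
  FibonacciModule (fib_iter_seq u v).

Lemma fib_init_iso : lmod_iso (fibonacci_module M a b) (M * M)%type.
Proof.
pose F x := (x 0%N, x 1%N).
have Flin : linear F by [].
pose f : {linear _ -> (M * M)%type} :=
  HB.pack F (GRing.isLinear.Build R _ (M * M)%type _ F Flin).
exists f.
exists (fun p => fib_init p.1 p.2) => [x|[u v]//].
exact: fib_eq.
Qed.

End FibonacciModuleTheory.

Lemma fib_tensor_iso (R : comPzRingType) (a b : R) (M : lmodType R) :
  lmod_iso (M * M)%type (tensor_product (fibonacci_module R^o a b) M).
Proof.
pose E := fibonacci_module R^o a b.
pose e0 : E := @fib_init R R^o a b 1 0; pose e1 : E := @fib_init R R^o a b 0 1.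
pose F (p : M * M) : tensor_product E M := tensor e0 p.1 + tensor e1 p.2.
have Flin : linear F.
  move=> c p q; rewrite /F /= !tensorDr !tensorZr scalerDr.
  by rewrite addrACA.
pose f : {linear (M * M)%type -> tensor_product E M} :=
  HB.pack F (GRing.isLinear.Build R _ (tensor_product E M) _ F Flin).
have [m|x|g gE] :=
    @tensor_lift R E M (M * M)%type (fun x m => ((x 0%N : R) *: m, (x 1%N : R) *: m)).
- move=> c x y; have cxy n : (c *: x + y) n = c * (x n : R) + y n by [].
  by rewrite !cxy !scalerDl -!scalerA.
- by move=> c m m'; rewrite !scalerDr !scalerA ![_ * c]mulrC -!scalerA.
exists f, g => [[u v]|].
  rewrite linearD !gE /= !scale1r !scale0r.
  by apply/pair_equal_spec; split; rewrite /= ?addr0 ?add0r.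
(* It suffices to treat a pure tensor. Moving the scalars [x 0] and [x 1] across to the left factor
   leaves the identity [x = x 0 *: e0 + x 1 *: e1], which [fib_eq] reduces to the two initial
   terms. *)
apply: (tensor_ext (p := f \o g) (q := idfun)) => x m /=.
rewrite gE /F /= !tensorZr -!tensorZl -tensorDl; congr (tensor _ m).
have xe n : ((x 0%N : R) *: e0 + (x 1%N : R) *: e1) n
  = (x 0%N : R) * e0 n + (x 1%N : R) * e1 n by [].
by apply: fib_eq; rewrite xe /= mulr1 mulr0 ?addr0 ?add0r.
Qed.

Theorem proposition1p3 (R : comPzRingType) (a b : R) (M : lmodType R) :
  lmod_iso (fibonacci_module M a b) (M * M)%type /\
  lmod_iso (M * M)%type (tensor_product (fibonacci_module R^o a b) M).
Proof. by split; [exact: fib_init_iso|exact: fib_tensor_iso]. Qed.
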